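(* For every positive integer $p$ there exists a constant $c=c(p)$ such that the following holds for all sufficiently large $n$: if $G$ is a $C_5$-free graph of order $n$ with $e_p(G)=ex_p(n,C_5)$, then $G$ is a complete bipartite graph having one vertex class of size $cn+o(n)$ and the other vertex class of size $(1-c)n+o(n)$.
   Context: All graphs are finite, simple and undirected. For a graph $G$ with degree sequence $d_1,\dots,d_n$ and a positive integer $p$, $e_p(G)=\sum_{i=1}^n d_i^p$. $C_5$ denotes the cycle on $5$ vertices, and a graph is $C_5$-free if it contains no subgraph isomorphic to $C_5$. $ex_p(n,C_5)$ denotes the maximum of $e_p(G)$ over all $C_5$-free graphs $G$ on $n$ vertices. The $o(n)$ terms refer to $n\to\infty$ with $p$ fixed. *)

(* Defs.v *)
From mathcomp Require Import all_boot.

Set Implicit Arguments.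
Unset Strict Implicit.
Unset Printing Implicit Defensive.

(* A graph on the vertex type T is given by its adjacency relation. *)
Definition simple_graph (T : finType) (e : rel T) : bool :=
  [forall x, ~~ e x x] && [forall x, forall y, e x y == e y x].

(* The copy of h in e need not be induced. *)
Definition contains (S T : finType) (h : rel S) (e : rel T) : bool :=
  [exists f : {ffun S -> T},
     injectiveb f && [forall x, forall y, h x y ==> e (f x) (f y)]].

Definition cycle_graph (k : nat) : rel 'I_k :=
  [rel i j : 'I_k | (j == i.+1 %% k :> nat) || (i == j.+1 %% k :> nat)].

Definition C5_free (T : finType) (e : rel T) : bool :=
  ~~ contains (@cycle_graph 5) e.

Definition degree (T : finType) (e : rel T) (x : T) : nat :=
  #|[set y | e x y]|.

Definition degree_power (p : nat) (T : finType) (e : rel T) : nat :=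
  \sum_(x : T) degree e x ^ p.

Definition adj (T : finType) (E : {set T * T}) : rel T :=
  [rel x y | (x, y) \in E].

(* The maximum ranges over labelled graphs on 'I_n, encoded by their sets of
   adjacent ordered pairs so as to form a finite type. *)
Definition ex_C5 (p n : nat) : nat :=
  \max_(E : {set 'I_n * 'I_n} | simple_graph (adj E) && C5_free (adj E))
    degree_power p (adj E).

Definition complete_bipartite (T : finType) (e : rel T) (A B : {set T}) : Prop :=
  [/\ A != set0, B != set0, A :|: B = [set: T], [disjoint A & B]
    & forall x y, e x y = (x \in A) && (y \in B) || (x \in B) && (y \in A)].

(* Main.v *)
(* Let G be extremal, v a vertex of maximum degree, N its neighbourhood and
   W the complement of N. Since G[N] has no path on four vertices, it has
   O(n) edges, so e_p(G) is at most e_p(K_{N,W}) + O(n^p) minus n^(p-1) times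
   a positive constant times the number of non-edges between N and W;
   extremality leaves only O(n) such non-edges and makes |N|, |W| linear in n.
   All but O(1) vertices then miss at most an eighth of the other side. Any two
   of these good vertices on the same side have several common good neighbours,
   so C5-freeness forbids a vertex with good neighbours on both sides, and an
   edge inside a part of the induced bipartition forces an endpoint of degree
   O(1). Such a vertex loses order n^p, whereas the O(1) bad vertices gain only
   O(n^(p-1)) in total. Hence G is bipartite, and then complete bipartite.

   The sizes of the classes maximise x (1-x)^p + (1-x) x^p over x = a/n. With
   v = (2x-1)^2 this is 2^-p (1-v) sum_j C(p-1,2j) v^j, whose non-constant
   coefficients change sign only once, from positive to negative; its maximiser
   over [0,1] is therefore unique. *)
Require Import Defs.
From mathcomp Require Import all_boot all_order all_algebra.
From mathcomp Require Import zify.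
Set Implicit Arguments.
Unset Strict Implicit.
Unset Printing Implicit Defensive.

(** * Reduction to complete bipartite graphs *)

(** Integer mean value bound: on [0, n] the power q+1 grows by at most (q+1) n^q per unit. It prices
    the extra edges of a vertex. *)
Lemma expn_add_le n q o i : o + i <= n ->
  (o + i) ^ q.+1 <= o ^ q.+1 + q.+1 * n ^ q * i.
Proof.
elim: q => [|q IHq] le_n; first by rewrite !expn1 mul1n expn0 mul1n.
have := IHq le_n; rewrite !(expnS _ q.+1) => IH.
have h1 : (o + i) * (o + i) ^ q.+1 <= (o + i) * (o ^ q.+1 + q.+1 * n ^ q * i).
  by rewrite leq_mul2l IH orbT.
have h2 : o ^ q.+1 <= n ^ q.+1 by rewrite leq_exp2r //; lia.
have h3 : (o + i) * n ^ q <= n ^ q.+1 by rewrite expnS leq_mul2r le_n orbT.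
have h4 : i * o ^ q.+1 <= i * n ^ q.+1 by rewrite leq_mul2l h2 orbT.
have h5 : q.+1 * i * ((o + i) * n ^ q) <= q.+1 * i * n ^ q.+1 by rewrite leq_mul2l h3 orbT.
nia.
Qed.

(** A deficit of b - o costs at least b^q per unit, because o^q <= b^q. It prices the missing
    edges. *)
Lemma expn_sub_le q o b : o <= b -> o ^ q.+1 + b ^ q * (b - o) <= b ^ q.+1.
Proof.
move=> le_ob; rewrite !expnSr.
have h : o ^ q <= b ^ q by case: (q) => // q'; rewrite leq_exp2r.
have h' : o ^ q * o <= b ^ q * o by rewrite leq_mul2r h orbT.
have -> : b ^ q * b = b ^ q * o + b ^ q * (b - o) by rewrite -mulnDr subnKC.
by rewrite leq_add2r.
Qed.

(** * Five-cycles, bipartite comparison graphs and the extremal number *)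

Section Graph.
Variables (T : finType) (e : rel T).

Lemma simple_graphP : reflect (irreflexive e /\ symmetric e) (simple_graph e).
Proof.
apply: (iffP andP) => -[h1 h2]; split.
- by move=> x; apply/negbTE/(forallP h1).
- by move=> x y; apply/eqP/(forallP (forallP h2 x)).
- by apply/forallP => x; rewrite h1.
- by apply/forallP => x; apply/forallP => y; rewrite h2.
Qed.

Lemma C5_freeP (sym_e : symmetric e) :
  reflect (forall a b c d f, uniq [:: a; b; c; d; f] ->
             e a b -> e b c -> e c d -> e d f -> e f a -> False) (C5_free e).
Proof.
apply: (iffP negP) => [C5F a b c d f Un ab bc cd df fa | noC5].
  apply: C5F; apply/existsP; exists [ffun i : 'I_5 => nth a [:: a; b; c; d; f] i].
  apply/andP; split.
    apply/injectiveP => i j; rewrite !ffunE => /eqP.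
    by rewrite nth_uniq // => /eqP /val_inj.
  have step (i : 'I_5) :
      e (nth a [:: a; b; c; d; f] i) (nth a [:: a; b; c; d; f] (i.+1 %% 5)).
    by case: i => -[|[|[|[|[|i]]]]].
  apply/forallP => i; apply/forallP => j; apply/implyP; rewrite !ffunE.
  by case/orP => /eqP ->; rewrite ?step // sym_e step.
case/existsP => g /andP [/injectiveP inj_g /forallP hom_g].
pose o i (h : i < 5) : 'I_5 := Ordinal h.
pose i0 := @o 0 isT; pose i1 := @o 1 isT; pose i2 := @o 2 isT.
pose i3 := @o 3 isT; pose i4 := @o 4 isT.
have hom i j : cycle_graph i j -> e (g i) (g j).
  by move=> h; move/forallP: (hom_g i) => /(_ j) /implyP; apply.
apply: (noC5 (g i0) (g i1) (g i2) (g i3) (g i4)); do ?by apply: hom.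
by rewrite -[X in uniq X]/(map g [:: i0; i1; i2; i3; i4]) map_inj_uniq.
Qed.
End Graph.

(** The complete bipartite graph with classes [A] and its complement, as an exclusive or, so that
    one set describes it. *)
Definition bip (T : finType) (A : {set T}) : rel T :=
  fun x y => (x \in A) (+) (y \in A).

(** Three common neighbours ensure that one survives after excluding any two vertices, which is what
    closing a five-cycle takes. *)
Definition rich (T : finType) (e : rel T) (P Q : {set T}) :=
  forall x1 x2, x1 \in P -> x2 \in P -> 2 < #|[set q in Q | e x1 q && e x2 q]|.

Section Bip.
Variables (T : finType) (A : {set T}).

Lemma bip_sym : symmetric (bip A).
Proof. by move=> x y; exact: addbC. Qed.

Lemma bip_simple : simple_graph (bip A).
Proof. by apply/simple_graphP; split; [move=> x; exact: addbb|exact: bip_sym]. Qed.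

Lemma bip_C5_free : C5_free (bip A).
Proof.
apply/(C5_freeP bip_sym) => a b c d f _; rewrite /bip.
by case: (a \in A); case: (b \in A); case: (c \in A); case: (d \in A); case: (f \in A).
Qed.

Lemma degree_bip x : degree (bip A) x = if x \in A then #|~: A| else #|A|.
Proof. by rewrite /degree; case: ifP => xA; apply: eq_card => y; rewrite !inE /bip xA. Qed.

Lemma degree_power_bip p :
  degree_power p (bip A) = #|A| * #|~: A| ^ p + #|~: A| * #|A| ^ p.
Proof.
rewrite /degree_power (bigID [in A]) /= -!sum_nat_const; congr (_ + _).
  by apply: eq_bigr => x xA; rewrite degree_bip xA.
by apply: eq_big => x; rewrite ?inE // => /negbTE xA; rewrite degree_bip xA.
Qed.
End Bip.

(** The maximum ranges over graphs on ordinals only, so [e] is transported along the enumeration of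
    [T]. *)
Lemma degree_power_ex_C5 (T : finType) (e : rel T) p n : #|T| = n ->
  simple_graph e -> C5_free e -> degree_power p e <= ex_C5 p n.
Proof.
move=> <-{n} /simple_graphP [irr_e sym_e] C5F.
pose E := [set u : 'I_#|T| * 'I_#|T| | e (enum_val u.1) (enum_val u.2)].
have adjE i j : adj E i j = e (enum_val i) (enum_val j) by rewrite /adj /= inE.
have sym_E : symmetric (adj E) by move=> i j; rewrite !adjE.
have simE : simple_graph (adj E).
  by apply/simple_graphP; split => // i; rewrite adjE.
have C5E : C5_free (adj E).
  apply/(C5_freeP sym_E) => a b c d f Un; rewrite !adjE.
  move/(C5_freeP sym_e): C5F; apply.
  by rewrite -[X in uniq X]/(map enum_val [:: a; b; c; d; f]) map_inj_uniq //; exact: enum_val_inj.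
rewrite /ex_C5; apply: (@leq_trans (degree_power p (adj E))); last first.
  by rewrite (bigD1 E) /= ?simE ?C5E // leq_maxl.
rewrite leq_eqVlt; apply/orP; left; apply/eqP.
have bij : {on [pred _ : T | true], bijective (@enum_val T predT)}.
  by apply: onW_bij; exact: enum_val_bij.
rewrite /degree_power (reindex _ bij); apply: eq_bigr => i _; congr (_ ^ _).
rewrite /degree -(card_imset _ (@enum_val_inj T predT)); apply: eq_card => y.
rewrite inE; apply/idP/imsetP => [exy | [j]].
  by exists (enum_rank y); rewrite ?enum_rankK // inE adjE enum_rankK.
by rewrite inE adjE => exy ->.
Qed.

Lemma bip_ex_C5 p n a : a <= n -> a * (n - a) ^ p + (n - a) * a ^ p <= ex_C5 p n.
Proof.
move=> le_an; pose A := [set widen_ord le_an i | i : 'I_a].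
have cardA : #|A| = a.
  by rewrite card_imset ?card_ord // => i j /(congr1 val) /= /val_inj.
have cardCA : #|~: A| = n - a by rewrite cardsCs setCK card_ord cardA.
have := degree_power_bip A p; rewrite cardA cardCA => <-.
by apply: degree_power_ex_C5; [rewrite card_ord|exact: bip_simple|exact: bip_C5_free].
Qed.

(** * Five-cycles forced by a rich pair of sets *)

Section Structure.
Variables (T : finType) (e : rel T).
Lemma rich_avoid (P Q : {set T}) x1 x2 z1 z2 : rich e P Q -> x1 \in P -> x2 \in P ->
  exists q, [/\ q \in Q, e x1 q, e x2 q, q != z1 & q != z2].
Proof.
move=> r x1P x2P; have := r _ _ x1P x2P; set S := [set q in Q | _] => gtS.
have /card_gt0P [q] : 0 < #|S :\: [set z1; z2]|.
  have := cardsID [set z1; z2] S; have := subset_leq_card (subsetIr S [set z1; z2]).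
  by rewrite cards2; case: (_ != _) => /=; lia.
by rewrite !inE negb_or => /andP [/andP [? ?] /andP [? /andP [? ?]]]; exists q.
Qed.

Hypotheses (irr_e : irreflexive e) (sym_e : symmetric e) (C5F : C5_free e).

Variables (P Q : {set T}).
Hypotheses (disPQ : [disjoint P & Q]) (rPQ : rich e P Q) (rQP : rich e Q P).

Let neqPQ x y : x \in P -> y \in Q -> x != y.
Proof. by move=> xP yQ; apply: contraTneq xP => ->; rewrite (disjointFl disPQ). Qed.

Let neq_e x y : e x y -> x != y.
Proof. by apply: contraTneq => ->; rewrite irr_e. Qed.

(** Otherwise z x w' x' w is a five-cycle, with w' a further neighbour of x in [Q] and x' a common
    neighbour of w and w' in [P]. *)
Lemma no_mixed_neighbours z x w : x \in P -> w \in Q -> e z x -> ~~ e z w.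
Proof.
move=> xP wQ zx; apply/negP => zw.
have [w' [w'Q xw' _ nw'w nw'z]] := rich_avoid w z rPQ xP xP.
have [x' [x'P wx' w'x' nx'x nx'z]] := rich_avoid x z rQP wQ w'Q.
move/(C5_freeP sym_e): C5F => /(_ z x w' x' w); apply => //; try by rewrite sym_e.
rewrite /= !inE !negb_or !(neq_e zx) (neq_e zw) (neqPQ xP w'Q) (neqPQ xP wQ) (neqPQ x'P wQ).
by rewrite ![z == _]eq_sym nw'z nx'z eq_sym nx'x nw'w eq_sym (neqPQ x'P w'Q).
Qed.

(** If both ends had two neighbours in [Q], distinct ones w of z and w' of z' could be chosen; a
    common neighbour x in [P] closes z w x w' z'. *)
Lemma inner_edge_few_neighbours z z' : e z z' ->
    (forall x, x \in P -> ~~ e z x) -> (forall x, x \in P -> ~~ e z' x) ->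
  (#|[set w in Q | e z w]| <= 1) || (#|[set w in Q | e z' w]| <= 1).
Proof.
move=> zz' zP z'P; rewrite leqNgt -implybE; apply/implyP => gtz; rewrite leqNgt; apply/negP => gtz'.
have /card_gt0P [w' ] : 0 < #|[set w in Q | e z' w]| by lia.
rewrite inE => /andP [w'Q z'w'].
have /card_gt0P [w] : 0 < #|[set w in Q | e z w] :\ w'|.
  by have := cardsD1 w' [set w in Q | e z w]; case: (_ \in _); lia.
rewrite !inE => /and3P [nww' wQ zw].
have [x [xP wx w'x nxz nxz']] := rich_avoid z z' rQP wQ w'Q.
move/(C5_freeP sym_e): C5F => /(_ z w x w' z'); apply => //; try by rewrite sym_e.
have nwz' : w != z'.
  by apply: contraTneq wx => ->; exact: z'P.
have nzw' : z != w'.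
  by apply: contraTneq w'x => <-; exact: zP.
rewrite /= !inE !negb_or (neq_e zw) eq_sym nxz nzw' (neq_e zz') eq_sym (neqPQ xP wQ) nww' nwz'.
by rewrite (neqPQ xP w'Q) nxz' eq_sym (neq_e z'w').
Qed.

Lemma good_independent x y : x \in P -> y \in P -> ~~ e x y.
Proof.
move=> xP yP; have [w [wQ xw _ _ _]] := rich_avoid x x rPQ xP xP.
by apply: contraL xw; exact: no_mixed_neighbours.
Qed.
End Structure.

Section Dichotomy.
Variables (T : finType) (e : rel T).
Hypotheses (irr_e : irreflexive e) (sym_e : symmetric e) (C5F : C5_free e).

(** Edges inside a class of [X] have both ends in [Z], which bounds the excess degrees. One end of
    such an edge has at most one neighbour outside [Z], hence degree at most |Z|+1. *)
Lemma rich_bipartition (P Q : {set T}) :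
    [disjoint P & Q] -> rich e P Q -> rich e Q P ->
  exists X : {set T}, let Z := ~: (P :|: Q) in
    [/\ P \subset X, Q \subset ~: X,
        forall v, degree e v <= degree (bip X) v + (v \in Z) * #|Z|
      & (forall x y, e x y -> bip X x y) \/ exists v, degree e v <= #|Z|.+1].
Proof.
move=> disPQ rPQ rQP; have disQP : [disjoint Q & P] by rewrite disjoint_sym.
(* Vertices without a neighbour in [P] join the side of [P]; any other vertex has a neighbour in
   [P], hence none in [Q]. *)
pose X := [set z | [forall x in P, ~~ e z x]]; exists X => Z.
have XP z x : z \in X -> x \in P -> e z x = false.
  by rewrite inE => /forall_inP zP /zP /negbTE.
have YQ z w : z \notin X -> w \in Q -> e z w = false.
  rewrite inE => /forall_inPn [x xP]; rewrite negbK => zx wQ.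
  exact/negbTE/(no_mixed_neighbours irr_e sym_e C5F disPQ rPQ rQP xP wQ).
have subPX : P \subset X.
  apply/subsetP => x xP; rewrite inE; apply/forall_inP => y yP.
  exact: (good_independent irr_e sym_e C5F disPQ rPQ rQP).
have subQY : Q \subset ~: X.
  apply/subsetP => x xQ; rewrite !inE.
  have [w [wP xw _ _ _]] := rich_avoid x x rQP xQ xQ.
  by apply/forall_inPn; exists w; rewrite ?negbK.
have inZ v : (v \in Z) = (v \notin P) && (v \notin Q) by rewrite !inE negb_or.
split=> // [v|].
  rewrite degree_bip; have [vX|vY] := ifPn.
    have sub : [set y | e v y] \subset ~: X :|: (if v \in Z then Z else set0).
      apply/subsetP => y; rewrite in_set => vy; rewrite in_setU in_setC.
      have [yX|] //= := boolP (y \in X).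
      have vP : v \notin P by apply: contraTN vy => vP; rewrite sym_e XP.
      have vQ : v \notin Q by apply: contraL vX => /(subsetP subQY); rewrite inE.
      have yP : y \notin P by apply: contraTN vy => yP; rewrite XP.
      have yQ : y \notin Q by apply: contraL yX => /(subsetP subQY); rewrite inE.
      by rewrite inZ vP vQ inZ yP yQ.
    apply: leq_trans (subset_leq_card sub) _.
    apply: leq_trans (leq_card_setU _ _) _; rewrite leq_add2l.
    by case: ifP => _; rewrite ?mul1n ?cards0.
  have sub : [set y | e v y] \subset X :|: (if v \in Z then Z else set0).
    apply/subsetP => y; rewrite in_set => vy; rewrite in_setU.
    have [yX|yX] //= := boolP (y \in X).
    have vP : v \notin P by apply: contra vY => /(subsetP subPX).
    have vQ : v \notin Q by apply: contraTN vy => vQ; rewrite sym_e YQ.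
    have yP : y \notin P by apply: contra yX => /(subsetP subPX).
    have yQ : y \notin Q by apply: contraTN vy => yQ; rewrite YQ.
    by rewrite inZ vP vQ inZ yP yQ.
  apply: leq_trans (subset_leq_card sub) _.
  apply: leq_trans (leq_card_setU _ _) _; rewrite leq_add2l.
  by case: ifP => _; rewrite ?mul1n ?cards0.
have [/existsP [z /existsP [z' /andP [zz' nb]]]|nex] :=
    boolP [exists z, exists z', e z z' && ~~ bip X z z']; last first.
  left=> x y xy; apply: contraNT nex => nb.
  by apply/existsP; exists x; apply/existsP; exists y; rewrite xy.
right.
(* Stated for a generic pair so that it serves inner edges on either side. *)
have low (A B : {set T}) u : ~: (A :|: B) = Z -> (forall x, x \in A -> ~~ e u x) ->
    #|[set w in B | e u w]| <= 1 -> degree e u <= #|Z|.+1.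
  move=> defZ uA leu; have sub : [set y | e u y] \subset [set w in B | e u w] :|: Z.
    rewrite -defZ; apply/subsetP => y; rewrite !inE => uy; rewrite uy andbT.
    by case: (y \in B); rewrite // orbF; apply: contraL uy; exact: uA.
  apply: leq_trans (subset_leq_card sub) _.
  by apply: leq_trans (leq_card_setU _ _) _; rewrite -add1n leq_add2r.
have [zX|zY] := boolP (z \in X).
  have z'X : z' \in X by move: nb; rewrite /bip zX; case: (_ \in _).
  have zP x : x \in P -> ~~ e z x by move=> xP; rewrite XP.
  have z'P x : x \in P -> ~~ e z' x by move=> xP; rewrite XP.
  have /orP [le1|le1] := inner_edge_few_neighbours irr_e sym_e C5F disPQ rQP zz' zP z'P.
    by exists z; exact: low zP le1.
  by exists z'; exact: low z'P le1.
have z'Y : z' \notin X by move: nb; rewrite /bip (negbTE zY); case: (_ \in _).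
have zQ x : x \in Q -> ~~ e z x by move=> xQ; rewrite YQ.
have z'Q x : x \in Q -> ~~ e z' x by move=> xQ; rewrite YQ.
have defZ : ~: (Q :|: P) = Z by rewrite setUC.
have /orP [le1|le1] := inner_edge_few_neighbours irr_e sym_e C5F disQP rPQ zz' zQ z'Q.
  by exists z; exact: low defZ zQ le1.
by exists z'; exact: low defZ z'Q le1.
Qed.

End Dichotomy.

(** * A vertex of bounded degree contradicts extremality *)

Section Compare.
Variables (T : finType) (e : rel T).

Lemma degree_le_card v : degree e v <= #|T|.
Proof. exact: max_card. Qed.

(** Passing to [bip X] gains at least (n/D)^(q+1) - (k+1)^(q+1) at [v0] and loses at most (q+1) n^q
    k at each of the at most k vertices of [Z]; the gain wins for large n. *)
Lemma degree_power_lt_bip (X Z : {set T}) q D k v0 :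
    #|Z| <= k -> #|T| <= D * #|X| -> #|T| <= D * #|~: X| ->
    (forall v, degree e v <= degree (bip X) v + (v \in Z) * #|Z|) ->
    degree e v0 <= #|Z|.+1 ->
    D ^ q.+1 * (k.+1 ^ q.+1 + q.+1 * k * k) < #|T| ->
  degree_power q.+1 e < degree_power q.+1 (bip X).
Proof.
set n := #|T| => leZk leX leY le_deg le_v0 lt_n.
have n_gt0 : 0 < n by apply: leq_ltn_trans lt_n.
have term v : degree e v ^ q.+1 + (v == v0) * degree (bip X) v ^ q.+1
    <= degree (bip X) v ^ q.+1 + ((v == v0) * k.+1 ^ q.+1 + (v \in Z) * (q.+1 * n ^ q * k)).
  have [->|nv] := eqVneq v v0.
    rewrite !mul1n addnC leq_add2l; apply: leq_trans (leq_addr _ _).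
    by rewrite leq_exp2r //; exact: leq_trans le_v0 _.
  rewrite !mul0n addn0 add0n.
  have [le_d|lt_d] := leqP (degree e v) (degree (bip X) v).
    by apply: leq_trans (leq_addr _ _); rewrite leq_exp2r.
  have eq_d : degree (bip X) v + (degree e v - degree (bip X) v) = degree e v.
    by rewrite subnKC // ltnW.
  have := @expn_add_le n q (degree (bip X) v) (degree e v - degree (bip X) v).
  rewrite eq_d => /(_ (degree_le_card v)) /leq_trans; apply.
  have := le_deg v; case: (v \in Z); last by move: lt_d; rewrite mul0n addn0; lia.
  rewrite !mul1n => le_dv; rewrite leq_add2l leq_mul2l; apply/orP; right.
  by lia.
have sum_delta (F : T -> nat) : \sum_v (v == v0) * F v = F v0.
  by rewrite (bigD1 v0) //= eqxx mul1n big1 ?addn0 // => v /negbTE ->.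
have cardZ : \sum_v (v \in Z) = #|Z|.
  by rewrite -sum1_card [RHS]big_mkcond; apply: eq_bigr => v _; case: (v \in Z).
have := @leq_sum _ (index_enum T) predT _ _ (fun v _ => term v).
rewrite !big_split /= !sum_delta -big_distrl /= cardZ => total.
have low_bip : n ^ q.+1 <= D ^ q.+1 * degree (bip X) v0 ^ q.+1.
  by rewrite -expnMn leq_exp2r // degree_bip; case: ifP.
rewrite -/(degree_power q.+1 e) -/(degree_power q.+1 (bip X)) in total *.
have lt_gain : k.+1 ^ q.+1 + #|Z| * (q.+1 * n ^ q * k) < degree (bip X) v0 ^ q.+1.
  have nq_gt0 : 0 < n ^ q by rewrite expn_gt0 n_gt0.
  have h1 : #|Z| * (q.+1 * n ^ q * k) <= q.+1 * k * k * n ^ q.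
    by rewrite [X in _ <= X](_ : _ = k * (q.+1 * n ^ q * k)) ?leq_mul2r ?leZk ?orbT //; lia.
  have h2 : k.+1 ^ q.+1 <= k.+1 ^ q.+1 * n ^ q by rewrite leq_pmulr.
  have h3 : D ^ q.+1 * (k.+1 ^ q.+1 + q.+1 * k * k) * n ^ q < n ^ q.+1.
    by rewrite [X in _ < X]expnS ltn_mul2r nq_gt0.
  have : D ^ q.+1 * (k.+1 ^ q.+1 + #|Z| * (q.+1 * n ^ q * k)) < D ^ q.+1 * degree (bip X) v0 ^ q.+1.
    apply: leq_trans low_bip; apply: leq_ltn_trans h3.
    by rewrite -[X in _ <= X]mulnA leq_mul2l mulnDl leq_add ?orbT.
  by rewrite ltn_mul2l => /andP [].
lia.
Qed.
End Compare.

(** * Non-edges between two sets and good vertices *)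

Section Missing.
Variables (T : finType) (e : rel T).

Definition missing (W : {set T}) x := [set w in W | ~~ e x w].
Definition good (N W : {set T}) := [set x in N | 8 * #|missing W x| <= #|W|].

Lemma card_set_sum (B : {set T}) (r : pred T) : #|[set y in B | r y]| = \sum_(y in B) r y.
Proof.
rewrite -sum1_card [LHS](eq_bigl (fun y => (y \in B) && r y)) => [|y]; last by rewrite inE.
by rewrite big_mkcondr; apply: eq_bigr => y _; case: (r y).
Qed.

Lemma sum_missing_sym (sym_e : symmetric e) (N W : {set T}) :
  \sum_(x in N) #|missing W x| = \sum_(w in W) #|missing N w|.
Proof.
under eq_bigr do rewrite card_set_sum.
rewrite exchange_big; apply: eq_bigr => w _; rewrite card_set_sum.
by apply: eq_bigr => x _; rewrite sym_e.
Qed.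

(** Markov's inequality: each bad vertex misses more than |W|/8 vertices. *)
Lemma card_bad (N W : {set T}) :
  #|N :\: good N W| * #|W| <= 8 * \sum_(x in N) #|missing W x|.
Proof.
rewrite -sum_nat_const big_distrr /= [X in _ <= X](big_setID (good N W)) /=.
apply: leq_trans (leq_addl _ _); apply: leq_sum => x.
by rewrite !inE negb_and -ltnNge => /andP [] /orP [/negbTE ->|/ltnW].
Qed.

(** Two good vertices together miss at most |W|/4, and at most k vertices of [W] are bad, so 3|W|/4
    - k >= 3 common good neighbours remain. *)
Lemma rich_good (N W : {set T}) k : #|W :\: good W N| <= k ->
  4 * (k + 3) <= 3 * #|W| -> rich e (good N W) (good W N).
Proof.
move=> le_bad large x1 x2; rewrite !inE => /andP [_ le1] /andP [_ le2].
set S := [set q in _ | _].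
have sub : W \subset S :|: (W :\: good W N) :|: (missing W x1 :|: missing W x2).
  apply/subsetP => w wW; rewrite !inE wW /=.
  by case: (e x1 w); case: (e x2 w); case: (_ <= _); rewrite ?orbT.
have := subset_leq_card sub.
have [] := leq_card_setU (S :|: (W :\: good W N)) (missing W x1 :|: missing W x2).
have [] := leq_card_setU S (W :\: good W N).
have [] := leq_card_setU (missing W x1) (missing W x2).
lia.
Qed.
End Missing.

(** * The neighbourhood of a vertex of maximum degree *)

Section MaxDegree.
Variables (T : finType) (e : rel T).
Hypotheses (irr_e : irreflexive e) (sym_e : symmetric e) (C5F : C5_free e).
Variable v : T.
Let N := [set y | e v y].
Let inner x := [set y in N | e x y].

(** A path z y x w inside [N] closes through v to a five-cycle, so every inner edge has an end of
    inner degree at most 2. Charging both orientations of each edge to such an end gives 2|N| +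
    2|N|. *)
Lemma sum_inner_degree : \sum_(x in N) #|inner x| <= 4 * #|N|.
Proof.
have small x y : x \in N -> y \in N -> e x y -> (#|inner x| <= 2) || (#|inner y| <= 2).
  rewrite !inE => vx vy xy; rewrite leqNgt -implybE; apply/implyP => gtx.
  rewrite leqNgt; apply/negP => gty.
  have /card_gt0P [z] : 0 < #|inner y :\ x|.
    by have := cardsD1 x (inner y); case: (_ \in _); lia.
  rewrite !inE => /and3P [nzx vz yz].
  have /card_gt0P [w] : 0 < #|inner x :\ y :\ z|.
    have := cardsD1 z (inner x :\ y); have := cardsD1 y (inner x).
    by do 2 case: (_ \in _); lia.
  rewrite !inE => /and4P [nwz nwy vw xw].
  move/(C5_freeP sym_e): C5F => /(_ v z y x w); apply => //; try by rewrite sym_e.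
  have neq_e s t : e s t -> s != t by apply: contraTneq => ->; rewrite irr_e.
  rewrite /= !inE !negb_or (neq_e _ _ vz) (neq_e _ _ vy) (neq_e _ _ vx) (neq_e _ _ vw).
  rewrite [z == y]eq_sym (neq_e _ _ yz) nzx eq_sym nwz.
  by rewrite [y == x]eq_sym (neq_e _ _ xy) eq_sym nwy (neq_e _ _ xw).
pose low x := #|inner x| <= 2.
have le_low : \sum_(x in N) low x * #|inner x| <= 2 * #|N|.
  rewrite mulnC -sum_nat_const; apply: leq_sum => x _; rewrite /low.
  by case: (leqP #|inner x| 2) => [|_]; rewrite ?mul1n.
have le1 : \sum_(x in N) #|inner x|
    <= \sum_(x in N) \sum_(y in N) (low x * e x y + low y * e x y).
  apply: leq_sum => x xN; rewrite card_set_sum; apply: leq_sum => y yN.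
  have := small x y xN yN; rewrite -/(low x) -/(low y).
  by case: (e x y) => // /(_ isT); case: (low x); case: (low y).
apply: leq_trans le1 _.
under eq_bigr do rewrite big_split /=.
rewrite big_split /= [X in _ + X]exchange_big /=.
rewrite (_ : 4 * #|N| = 2 * #|N| + 2 * #|N|); last by lia.
apply: leq_add; apply: leq_trans le_low; apply: leq_sum => x xN;
  rewrite -big_distrr /= card_set_sum // leq_mul2l; apply/orP; right.
by apply: leq_sum => y _; rewrite sym_e.
Qed.

Hypothesis max_v : forall x, degree e x <= degree e v.

(** Vertices outside [N] have degree at most |N| by maximality. A vertex of [N] is compared with |~:
    N|: its inner edges add at most (q+1) n^q each, its missing edges subtract at least |~: N|^q
    each. *)
Lemma degree_power_upper q :
  degree_power q.+1 e + #|~: N| ^ q * (\sum_(x in N) #|missing e (~: N) x|)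
    <= #|~: N| * #|N| ^ q.+1 + #|N| * #|~: N| ^ q.+1 + 4 * q.+1 * #|T| ^ q * #|N|.
Proof.
rewrite /degree_power (bigID [in N]) /= addnAC addnC -addnA.
apply: leq_add.
  rewrite -sum_nat_const (eq_bigl [in ~: N]) => [|x]; last by rewrite in_setC.
  by apply: leq_sum => x _; rewrite leq_exp2r.
rewrite big_distrr -big_split /=.
apply: (@leq_trans (\sum_(x in N) (#|~: N| ^ q.+1 + q.+1 * #|T| ^ q * #|inner x|))).
  apply: leq_sum => x xN; pose o := #|[set w in ~: N | e x w]|.
  have degx : degree e x = o + #|inner x|.
    rewrite /degree -(cardsID N) addnC; congr (_ + _);
      apply: eq_card => y; rewrite !inE andbC //.
  have outx : o + #|missing e (~: N) x| = #|~: N|.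
    rewrite -(cardsID [set w | e x w] (~: N)); congr (_ + _);
      apply: eq_card => y; rewrite !inE // andbC //.
  have leT : o + #|inner x| <= #|T| by rewrite -degx degree_le_card.
  have := expn_add_le q leT; rewrite degx.
  have := @expn_sub_le q o #|~: N|; rewrite -outx leq_addr addKn => /(_ isT).
  lia.
rewrite big_split /= sum_nat_const leq_add2l -big_distrr /=.
rewrite (_ : 4 * _ * _ * _ = q.+1 * #|T| ^ q * (4 * #|N|)); last by rewrite mulnCA !mulnA.
by rewrite leq_mul2l sum_inner_degree orbT.
Qed.

End MaxDegree.

(** The half split yields order n^(q+2), while the right side is at most n^q (2ab + 4(q+1)a). So ab
    is at least n^2 / (4C), which bounds a and b below since both are at most n. The constant C =
    3^(q+2) comes from n <= 3 [n./2]. *)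
Lemma balanced_sizes q n a b : a + b = n -> 1 < n -> 8 * 3 ^ q.+2 * q.+1 <= n ->
    n./2 * (n - n./2) ^ q.+1 + (n - n./2) * n./2 ^ q.+1
      <= b * a ^ q.+1 + a * b ^ q.+1 + 4 * q.+1 * n ^ q * a ->
  n <= 4 * 3 ^ q.+2 * a /\ n <= 4 * 3 ^ q.+2 * b.
Proof.
move=> defn n_gt1 n_large lower; set C := 3 ^ q.+2 in n_large *.
set h := n./2 in lower; have hE := odd_double_half n; rewrite -/h -mul2n in hE.
have le_h : h <= n - h by case: (odd n) hE => /=; lia.
have le_3h : n <= 3 * h by case: (odd n) hE => /=; lia.
have nq_gt0 : 0 < n ^ q by rewrite expn_gt0; lia.
have h1 : n ^ q.+2 <= C * h ^ q.+2 by rewrite -expnMn leq_exp2r.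
have h2 : h ^ q.+2 <= h * (n - h) ^ q.+1 by rewrite expnS leq_mul2l leq_exp2r // le_h orbT.
have le_a : a ^ q <= n ^ q by case: (q) => // q'; rewrite leq_exp2r //; lia.
have le_b : b ^ q <= n ^ q by case: (q) => // q'; rewrite leq_exp2r //; lia.
have h3 : b * a ^ q.+1 + a * b ^ q.+1 <= n ^ q * (2 * a * b).
  have ha : (a * b) * a ^ q <= (a * b) * n ^ q by rewrite leq_mul2l le_a orbT.
  have hb : (a * b) * b ^ q <= (a * b) * n ^ q by rewrite leq_mul2l le_b orbT.
  by rewrite !expnS; move: ha hb; set A := a ^ q; set B := b ^ q; set M := n ^ q; lia.
have h4 : n ^ q.+2 <= n ^ q * (C * (2 * a * b + 4 * q.+1 * a)).
  apply: leq_trans h1 _; rewrite mulnCA leq_mul2l; apply/orP; right.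
  apply: leq_trans h2 _; apply: leq_trans (leq_addr _ _) _.
  apply: leq_trans lower _; rewrite mulnDr; apply: leq_add => //.
  by rewrite [4 * _ * _]mulnC -mulnA.
have h5 : n * n <= C * (2 * a * b + 4 * q.+1 * a).
  by rewrite -(leq_pmul2l nq_gt0); apply: leq_trans h4; rewrite !expnS mulnC mulnA.
have h6 : 8 * C * q.+1 * a <= n * n by apply: leq_mul => //; lia.
have h7 : n * n <= n * (4 * C * a) /\ n * n <= n * (4 * C * b).
  have : n * n <= 4 * C * (a * b) by lia.
  have : a * b <= n * a by rewrite mulnC leq_mul2r; lia.
  have : a * b <= n * b by rewrite leq_mul2r; lia.
  move=> /(leq_mul (leqnn (4 * C))) ? /(leq_mul (leqnn (4 * C))) ?.
  lia.
by case: h7; rewrite !leq_pmul2l; lia.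
Qed.

(** * From few non-edges to an exactly complete bipartite graph *)

Section Near.
Variables (T : finType) (e : rel T).
Hypotheses (irr_e : irreflexive e) (sym_e : symmetric e) (C5F : C5_free e).

(** [N] is the neighbourhood of a vertex of maximum degree. The upper bound is played against two
    competitors: the half split gives linear sizes, and the split at |N| cancels the main terms,
    leaving the missing edges against an error of order n^(q+1). The factor D^q in [K] trades n^q
    for |~: N|^q. *)
Lemma near_bipartite q (D := 4 * 3 ^ q.+2) (K := 4 * q.+1 * D ^ q) :
    1 < #|T| -> 8 * 3 ^ q.+2 * q.+1 <= #|T| ->
    (forall a, a <= #|T| ->
       a * (#|T| - a) ^ q.+1 + (#|T| - a) * a ^ q.+1 <= degree_power q.+1 e) ->
  exists N : {set T}, [/\ #|T| <= D * #|N|, #|T| <= D * #|~: N|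
    & \sum_(x in N) #|missing e (~: N) x| <= K * #|T|].
Proof.
move=> T_gt1 T_large lower.
have [v0 _] : exists v0 : T, v0 \in T by apply/card_gt0P; exact: ltnW.
pose v := [arg max_(x > v0) degree e x].
have max_v x : degree e x <= degree e v.
  by rewrite /v; case: arg_maxnP => // y _ /(_ x); apply.
have upper := degree_power_upper irr_e sym_e C5F max_v q.
move: upper; set N := [set y | e v y]; set m := \sum_(x in N) _ => upper.
exists N; have cardN := cardsC N; set n := #|T| in T_gt1 T_large lower upper cardN *.
have [sa sb] : n <= D * #|N| /\ n <= D * #|~: N|.
  apply: balanced_sizes => //; apply: leq_trans (lower n./2 _) _; first by lia.
  exact: leq_trans (leq_addr _ _) upper.
split=> //; have bq_gt0 : 0 < #|~: N| ^ q by rewrite expn_gt0; lia.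
have lowN := lower #|N| _; rewrite -{2 3}cardN addKn in lowN.
have m_le : #|~: N| ^ q * m <= 4 * q.+1 * n ^ q * n.
  have : 4 * q.+1 * n ^ q * #|N| <= 4 * q.+1 * n ^ q * n by rewrite leq_mul2l; lia.
  by have := lowN _; lia.
rewrite -(leq_pmul2l bq_gt0); apply: leq_trans m_le _.
rewrite /K [X in _ <= X](_ : _ = 4 * q.+1 * (D ^ q * #|~: N| ^ q) * n); last by lia.
rewrite leq_mul2r leq_mul2l -expnMn; apply/orP; right; apply/orP; right.
by case: (q) => // q'; rewrite leq_exp2r.
Qed.
(** k = 8KD bounds the bad vertices of each side. Extremality excludes a low-degree vertex, so [e]
    lies inside some [bip X], and equal degree powers force equal degrees, hence equal graphs. *)
Lemma bip_of_near_bipartite q D K (N : {set T}) (k := 8 * K * D) :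
    #|T| <= D * #|N| -> #|T| <= D * #|~: N| ->
    \sum_(x in N) #|missing e (~: N) x| <= K * #|T| -> D * (4 * (k + 3)) <= #|T| ->
    (2 * D) ^ q.+1 * ((2 * k).+1 ^ q.+1 + q.+1 * (2 * k) * (2 * k)) < #|T| ->
    (forall X : {set T}, degree_power q.+1 (bip X) <= degree_power q.+1 e) ->
  exists X : {set T}, [/\ X != set0, ~: X != set0 & e =2 bip X].
Proof.
move=> sa sb sm; rewrite {}/k; set k := 8 * K * D => T_k large ext.
have T_gt0 : 0 < #|T| by apply: leq_ltn_trans large.
have D_gt0 : 0 < D by lia.
have bad (A B : {set T}) : \sum_(x in A) #|missing e B x| <= K * #|T| -> #|T| <= D * #|B| ->
    #|A :\: good e A B| <= k.
  move=> le_m leB; have B_gt0 : 0 < #|B| by lia.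
  rewrite -(leq_pmul2r B_gt0); apply: leq_trans (card_bad e A B) _.
  rewrite -!mulnA leq_mul2l /=; apply: leq_trans le_m _.
  by rewrite leq_mul2l leB orbT.
have badN := bad _ _ sm sb.
have badW : #|~: N :\: good e (~: N) N| <= k.
  by apply: bad => //; rewrite -sum_missing_sym.
have la : 4 * (k + 3) <= #|N| by rewrite -(leq_pmul2l D_gt0); exact: leq_trans sa.
have lb : 4 * (k + 3) <= #|~: N| by rewrite -(leq_pmul2l D_gt0); exact: leq_trans sb.
set P := good e N (~: N) in badN; set Q := good e (~: N) N in badW.
have rPQ : rich e P Q by apply: rich_good badW _; lia.
have rQP : rich e Q P by apply: rich_good badN _; lia.
have disPQ : [disjoint P & Q].
  by rewrite disjoint_subset; apply/subsetP => x; rewrite !inE => /andP [->].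
have [X [subPX subQY le_deg dich]] := rich_bipartition irr_e sym_e C5F disPQ rPQ rQP.
have leZ : #|~: (P :|: Q)| <= 2 * k.
  rewrite mul2n -addnn; apply: leq_trans (leq_add badN badW).
  apply: leq_trans (leq_card_setU _ _).1.
  apply: subset_leq_card; apply/subsetP => x; rewrite !inE negb_or.
  by case: (x \in N); rewrite //= ?orbF ?andbT.
(* At most k vertices are bad and |N| >= 4(k+3), so at least half are good; this is where 2D
   replaces D. *)
have halfP : #|N| <= 2 * #|P|.
  have := cardsID P N; have := subset_leq_card (subsetIr N P); lia.
have halfQ : #|~: N| <= 2 * #|Q|.
  have := cardsID Q (~: N); have := subset_leq_card (subsetIr (~: N) Q); lia.
have leX : #|T| <= 2 * D * #|X|.
  have := subset_leq_card subPX; nia.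
have leY : #|T| <= 2 * D * #|~: X|.
  have := subset_leq_card subQY; nia.
exists X; have X_neq0 : X != set0 by rewrite -card_gt0; lia.
have Y_neq0 : ~: X != set0 by rewrite -card_gt0; lia.
have bip_le : degree_power q.+1 (bip X) <= degree_power q.+1 e.
  exact: ext.
case: dich => [sub_e|[v0 low_v0]]; last first.
  by have := degree_power_lt_bip leZ leX leY le_deg low_v0 large; rewrite ltnNge bip_le.
split=> //.
have sub_v x : [set y | e x y] \subset [set y | bip X x y].
  by apply/subsetP => y; rewrite !inE; exact: sub_e.
have le_term x : true -> degree e x ^ q.+1 <= degree (bip X) x ^ q.+1.
  by move=> _; rewrite leq_exp2r // subset_leq_card.
have eq_sum : degree_power q.+1 e = degree_power q.+1 (bip X).
  by apply/eqP; rewrite eqn_leq bip_le andbT; apply: leq_sum => z; exact: le_term.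
move=> x y; have eq_deg : degree e x = degree (bip X) x.
  (* Equality of the sums forces equality in every term. *)
  have [_] := leqif_sum (fun x (_ : true) => leqif_eq (le_term x isT)).
  rewrite [_ == _](introT eqP eq_sum) => /esym /forallP /(_ x) /=.
  by rewrite eqn_exp2r // => /eqP.
have /eqP eq_nb : [set y | e x y] == [set y | bip X x y].
  by rewrite eqEcard sub_v -/(degree e x) -/(degree (bip X) x) eq_deg leqnn.
by have := congr1 (fun B : {set T} => y \in B) eq_nb; rewrite !inE.
Qed.
End Near.

Lemma extremal_is_bip q : exists n0, forall (T : finType) (e : rel T),
    n0 <= #|T| -> simple_graph e -> C5_free e ->
    degree_power q.+1 e = ex_C5 q.+1 #|T| ->
  exists X : {set T}, [/\ X != set0, ~: X != set0 & e =2 bip X].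
Proof.
(* From here only the existence of constants depending on q alone matters. *)
have [D [K near]] : exists D K, forall (T : finType) (e : rel T),
    irreflexive e -> symmetric e -> C5_free e -> 1 < #|T| -> 8 * 3 ^ q.+2 * q.+1 <= #|T| ->
    (forall a, a <= #|T| ->
       a * (#|T| - a) ^ q.+1 + (#|T| - a) * a ^ q.+1 <= degree_power q.+1 e) ->
  exists N : {set T}, [/\ #|T| <= D * #|N|, #|T| <= D * #|~: N|
    & \sum_(x in N) #|missing e (~: N) x| <= K * #|T|].
  exists (4 * 3 ^ q.+2), (4 * q.+1 * (4 * 3 ^ q.+2) ^ q) => T e irr_e sym_e C5F.
  exact: near_bipartite.
pose k := 8 * K * D.
exists (maxn 2 (maxn (8 * 3 ^ q.+2 * q.+1) (maxn (D * (4 * (k + 3)))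
  ((2 * D) ^ q.+1 * ((2 * k).+1 ^ q.+1 + q.+1 * (2 * k) * (2 * k))).+1))).
move=> T e; rewrite !geq_max => /and4P [T_gt1 T_large T_k T_kk] simp_e C5F ext.
have /simple_graphP [irr_e sym_e] := simp_e.
have [|N [sa sb sm]] := near _ _ irr_e sym_e C5F T_gt1 T_large.
  by move=> a le_a; rewrite ext; exact: bip_ex_C5.
apply: (bip_of_near_bipartite irr_e sym_e C5F sa sb sm T_k T_kk) => X.
by rewrite ext; apply: degree_power_ex_C5 => //; [exact: bip_simple|exact: bip_C5_free].
Qed.

From mathcomp Require Import all_classical all_reals all_analysis.
From mathcomp Require Import polyrcf ring lra.
Import Order.TTheory GRing.Theory Num.Theory.
Import numFieldNormedType.Exports.
Local Open Scope classical_set_scope.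
Local Open Scope ring_scope.

(** * The optimal class sizes *)

Section OneSignChange.
Variable R : rcfType.

(** Multiplying by x turns p' into d = sum_j j p_j x^j, and scaling w to v by t gives d(v) < t^m
    d(w); the negative coefficient at [J] makes this strict. *)
Lemma deriv_neg_after_sign_change (p : {poly R}) m J (w v : R) :
    (forall j, (0 < j <= m)%N -> 0 <= p`_j) -> (forall j, (m < j)%N -> p`_j <= 0) ->
    (m < J)%N -> p`_J < 0 -> 0 < w -> w < v -> p^`().[w] <= 0 -> p^`().[v] < 0.
Proof.
move=> ge0 le0 mJ pJ w_gt0 ltwv dw_le0; have v_gt0 := lt_trans w_gt0 ltwv.
pose d := 'X * p^`(); pose t := v / w.
have t_gt1 : 1 < t by rewrite /t ltr_pdivlMr // mul1r.
have t_gt0 : 0 < t by apply: lt_trans t_gt1.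
have dE x : d.[x] = x * p^`().[x] by rewrite hornerM hornerX.
have coefd j : d`_j = p`_j *+ j by rewrite coefXM coef_deriv; case: j.
(* Termwise: t^j <= t^m for the nonnegative terms (j <= m), t^j >= t^m for the
   nonpositive ones (j > m). *)
suff : d.[v] < t ^+ m * d.[w].
  rewrite !dE => lt_d; rewrite -(pmulr_rlt0 _ v_gt0); apply: lt_le_trans lt_d _.
  by rewrite pmulr_rle0 ?exprn_gt0 // pmulr_rle0.
have ltJ : (J < size d)%N.
  by rewrite ltnNge; apply: contraTN pJ => /leq_sizeP /(_ J (leqnn J)); rewrite coefd => /eqP;
    rewrite mulrn_eq0 => /orP [/eqP|/eqP ->]; [lia|rewrite ltxx].
have vE j : d`_j * v ^+ j = t ^+ j * (d`_j * w ^+ j).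
  by rewrite mulrCA -exprMn /t divfK ?gt_eqF.
have term j : d`_j * v ^+ j <= t ^+ m * (d`_j * w ^+ j).
  rewrite vE; case: (posnP j) => [->|j_gt0]; first by rewrite coefd mulr0n mul0r !mulr0.
  have wj_gt0 : 0 < w ^+ j by rewrite exprn_gt0.
  case: (leqP j m) => le_jm.
    rewrite ler_wpM2r ?ler_weXn2l ?(ltW t_gt1) // coefd.
    by rewrite mulr_ge0 ?(ltW wj_gt0) // mulrn_wge0 // ge0 // j_gt0.
  rewrite ler_wnM2r ?ler_weXn2l ?(ltW t_gt1) ?(ltnW le_jm) // coefd.
  by rewrite mulr_le0_ge0 ?(ltW wj_gt0) // mulrn_wle0 // le0.
rewrite !horner_coef big_distrr /=.
rewrite (bigD1 (Ordinal ltJ)) //= [X in _ < X](bigD1 (Ordinal ltJ)) //=.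
apply: ltr_leD; last by apply: ler_sum => j _.
rewrite vE ltr_nM2r ?ltr_eXn2l // coefd pmulr_llt0 ?exprn_gt0 //.
by rewrite pmulrn_llt0 //; lia.
Qed.

(** If p(v1) >= p(v2), the mean value theorem gives a point w1 with p' <= 0. Then p' < 0 beyond w1,
    so p(w1) > p(v2), against maximality. *)
Lemma horner_lt_of_sign_change (p : {poly R}) m J (v1 v2 : R) :
    (forall j, (0 < j <= m)%N -> 0 <= p`_j) -> (forall j, (m < j)%N -> p`_j <= 0) ->
    (m < J)%N -> p`_J < 0 -> 0 <= v1 -> v1 < v2 ->
    (forall x, v1 <= x <= v2 -> p.[x] <= p.[v2]) -> p.[v1] < p.[v2].
Proof.
move=> ge0 le0 mJ pJ v1_ge0 lt12 max2.
have [w1 w1in ->] : exists2 w, w \in `]v1, v2[ & p.[v1] = p.[v2] - p^`().[w] * (v2 - v1).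
  by have [w win eq] := poly_mvt p lt12; exists w => //; rewrite -eq opprB addrC subrK.
move: w1in; rewrite in_itv /= => /andP [lt1 lt2].
rewrite gtrBl mulr_gt0 ?subr_gt0 // ltNge; apply/negP => dw_le0.
have [w2] := poly_mvt p lt2; rewrite in_itv /= => /andP [lt1' lt2'] eq2.
have : p^`().[w2] < 0.
  by apply: (deriv_neg_after_sign_change ge0 le0 mJ pJ) dw_le0 => //; exact: le_lt_trans lt1.
have := max2 w1; rewrite (ltW lt1) (ltW lt2) => /(_ isT); rewrite -subr_ge0 eq2.
by rewrite pmulr_lge0 ?subr_gt0 // leNgt => /negP.
Qed.
End OneSignChange.

(** * Even part of the binomial expansion and its unique maximiser *)

Section EvenPart.
Variable R : realType.
Implicit Types (u x : R) (k : nat).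

Definition even_bin k : {poly R} := \poly_(j < k.+1) ('C(k, j.*2))%:R.
Definition odd_bin k : {poly R} := \poly_(j < k.+1) ('C(k, j.*2.+1))%:R.

Lemma coef_even_bin k j : (even_bin k)`_j = ('C(k, j.*2))%:R.
Proof. by rewrite coef_poly; case: ltnP => // ?; rewrite bin_small //; lia. Qed.

Lemma coef_odd_bin k j : (odd_bin k)`_j = ('C(k, j.*2.+1))%:R.
Proof. by rewrite coef_poly; case: ltnP => // ?; rewrite bin_small //; lia. Qed.

Lemma even_binS k : even_bin k.+1 = even_bin k + 'X * odd_bin k.
Proof.
apply/polyP => -[|j]; rewrite coefD coefXM !coef_even_bin ?coef_odd_bin /= ?bin0 ?addr0 //.
by rewrite doubleS binS natrD.
Qed.

Lemma odd_binS k : odd_bin k.+1 = even_bin k + odd_bin k.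
Proof. by apply/polyP => j; rewrite coefD !coef_odd_bin coef_even_bin binS natrD addrC. Qed.

Lemma expr1D_even_odd k u :
  (1 + u) ^+ k = (even_bin k).[u ^+ 2] + u * (odd_bin k).[u ^+ 2].
Proof.
elim: k => [|k IHk].
  have -> : even_bin 0 = 1 by apply/polyP => -[|j]; rewrite coef_even_bin coef1 /= ?bin0 ?bin0n.
  have -> : odd_bin 0 = 0 by apply/polyP => -[|j]; rewrite coef_odd_bin coef0 /= ?bin0n.
  by rewrite !hornerE.
by rewrite exprS IHk even_binS odd_binS !hornerE; ring.
Qed.

(** With k = p - 1 and v = (2x-1)^2, this is 2^p times the function of x to be maximised. *)
Definition profile k : {poly R} := (1 - 'X) * even_bin k.

Lemma bip_profile k x :
  2 ^+ k.+1 * (x * (1 - x) ^+ k.+1 + (1 - x) * x ^+ k.+1) = (profile k).[(2 * x - 1) ^+ 2].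
Proof.
set u := 2 * x - 1.
have hx : (2 * x) ^+ k = (even_bin k).[u ^+ 2] + u * (odd_bin k).[u ^+ 2].
  by rewrite -expr1D_even_odd /u; congr (_ ^+ _); ring.
have hy : (2 * (1 - x)) ^+ k = (even_bin k).[u ^+ 2] - u * (odd_bin k).[u ^+ 2].
  by rewrite -mulNr -[u ^+ 2]sqrrN -expr1D_even_odd /u; congr (_ ^+ _); ring.
rewrite (_ : _ * _ = 2 * x * (1 - x) * ((2 * (1 - x)) ^+ k + (2 * x) ^+ k)).
  rewrite hx hy /profile hornerM hornerD hornerN hornerC hornerX.
  by move: (_.[_]) (_.[_]) => E O; rewrite /u; ring.
by rewrite !exprMn !exprS; ring.
Qed.

(** The ratio of C(k,i+2) to C(k,i) is (k-i)(k-i-1) / ((i+1)(i+2)), which decreases in i. *)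
Lemma bin_step k i : ('C(k, i.+2) <= 'C(k, i))%N -> ('C(k, i.+4) <= 'C(k, i.+2))%N.
Proof.
move=> le_i; have [lt_ki|le_ik] := ltnP k i; first by rewrite bin_small //; lia.
have step l : ((l.+2 * l.+1) * 'C(k, l.+2) = ((k - l.+1) * (k - l)) * 'C(k, l))%N.
  by rewrite mulnAC mul_bin_left mulnAC -mulnA mul_bin_left mulnA.
have bin_pos : (0 < 'C(k, i))%N by rewrite bin_gt0.
have le_coef : ((k - i.+1) * (k - i) <= i.+2 * i.+1)%N.
  by rewrite -(leq_pmul2r bin_pos) -step leq_mul2l le_i orbT.
rewrite -(@leq_pmul2l (i.+4 * i.+3)) // step leq_mul2r; apply/orP; right.
have h1 : (k - i.+3 <= k - i.+1)%N by lia.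
have h2 : (k - i.+2 <= k - i)%N by lia.
by apply: leq_trans (leq_mul h1 h2) (leq_trans le_coef _); apply: leq_mul; lia.
Qed.

Lemma coef_profileS k j :
  (profile k)`_j.+1 = ('C(k, j.*2.+2))%:R - ('C(k, j.*2))%:R.
Proof. by rewrite /profile mulrBl mul1r coefB coefXM !coef_even_bin. Qed.

Lemma profile_sign_change k : exists m J,
  [/\ forall j, (0 < j <= m)%N -> 0 <= (profile k)`_j,
      forall j, (m < j)%N -> (profile k)`_j <= 0,
      (m < J)%N & (profile k)`_J < 0].
Proof.
have ex_m : exists m, ('C(k, m.*2.+2) <= 'C(k, m.*2))%N.
  by exists k; rewrite bin_small //; lia.
case: (ex_minnP ex_m) => m le_m min_m.
have le0 j : (m <= j)%N -> ('C(k, j.*2.+2) <= 'C(k, j.*2))%N.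
  by move=> /subnK <-; elim: (j - m)%N => [|l IHl] //; rewrite addSn doubleS bin_step.
have ge0 j : (j < m)%N -> ('C(k, j.*2) < 'C(k, j.*2.+2))%N.
  by move=> lt_jm; rewrite ltnNge; apply: contraL lt_jm => /min_m; rewrite leqNgt.
(* [m] is the first index where the even binomials stop increasing. At [k./2.+1] the coefficient is
   -C(k, 2 [k./2]), since the next even binomial vanishes. *)
exists m, k./2.+1; split=> [[|j] // /andP [_ lt_jm]|[|j] // le_mj||].
- by rewrite coef_profileS subr_ge0 ler_nat ltnW // ge0.
- by rewrite coef_profileS subr_le0 ler_nat le0.
- rewrite ltnNge; apply/negP => /ge0.
  by rewrite [X in (_ < X)%N]bin_small //; lia.
- by rewrite coef_profileS subr_lt0 ltr_nat bin_small ?bin_gt0; lia.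
Qed.

Lemma profile_argmax_unique k (v1 v2 : R) : 0 <= v1 <= 1 -> 0 <= v2 <= 1 ->
    (forall v, 0 <= v <= 1 -> (profile k).[v] <= (profile k).[v2]) ->
  (profile k).[v1] = (profile k).[v2] -> v1 = v2.
Proof.
move=> /andP [v1_ge0 v1_le1] /andP [v2_ge0 v2_le1] max2 eq12.
have [m [J [ge0 le0 mJ pJ]]] := profile_sign_change k.
have no_lt (a b : R) : 0 <= a -> b <= 1 -> a < b ->
    (profile k).[a] = (profile k).[b] ->
    (forall v, 0 <= v <= 1 -> (profile k).[v] <= (profile k).[b]) -> False.
  move=> a_ge0 b_le1 ltab eqab max_b.
  suff : (profile k).[a] < (profile k).[b] by rewrite eqab ltxx.
  apply: (horner_lt_of_sign_change ge0 le0 mJ pJ) => // x /andP [leax lexb].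
  by apply: max_b; rewrite (le_trans a_ge0 leax) (le_trans lexb).
have [lt12|lt21|//] := ltgtP v1 v2; first by case: (no_lt v1 v2).
by case: (no_lt v2 v1) => // v v01; rewrite eq12; exact: max2.
Qed.
End EvenPart.

(** * The limiting density and its maximisers *)

Section Density.
Variable R : realType.
Implicit Types (x : R) (k : nat).

Definition density k : {poly R} := 'X * (1 - 'X) ^+ k.+1 + (1 - 'X) * 'X ^+ k.+1.

Lemma densityE k x : (density k).[x] = x * (1 - x) ^+ k.+1 + (1 - x) * x ^+ k.+1.
Proof. by rewrite /density !hornerE. Qed.

(** A maximiser exists by compactness. Its value of (2x-1)^2 is unique, which determines x up to
    exchanging the classes. *)
Lemma density_argmax k : exists c : R, [/\ 0 <= c <= 1,
    forall x, 0 <= x <= 1 -> (density k).[x] <= (density k).[c] &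
    forall x, 0 <= x <= 1 -> (density k).[x] = (density k).[c] -> x = c \/ x = 1 - c].
Proof.
have [c c01 max_c] := @EVT_max R (horner (density k)) 0 1 ler01
  (continuous_subspaceT (@continuous_horner _ _)).
rewrite in_itv /= in c01; have max_c' x : 0 <= x <= 1 -> (density k).[x] <= (density k).[c].
  by move=> x01; apply: max_c; rewrite in_itv.
exists c; split=> // x x01 eq_xc.
have profE (y : R) : (profile R k).[(2 * y - 1) ^+ 2] = 2 ^+ k.+1 * (density k).[y].
  by rewrite -bip_profile densityE.
have sq01 (y : R) : 0 <= y <= 1 -> 0 <= (2 * y - 1) ^+ 2 <= 1 
    by move=> /andP [y_ge0 y_le1]; rewrite sqr_ge0 expr2; nra.
have : (2 * x - 1) ^+ 2 = (2 * c - 1) ^+ 2.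
  apply: (@profile_argmax_unique _ k _ _ (sq01 _ x01) (sq01 _ c01)) => [v /andP [v_ge0 v_le1]|].
    (* Every v in [0,1] is (2y-1)^2 for this y, so maximality passes from the density to the
       profile. *)
    pose y := (1 + Num.sqrt v) / 2.
    have -> : v = (2 * y - 1) ^+ 2 by rewrite -[LHS]sqr_sqrtr // /y; congr (_ ^+ _); field.
    rewrite !profE ler_pM2l ?exprn_gt0 //; apply: max_c'.
    have := sqrtr_ge0 v; have : Num.sqrt v <= 1 by rewrite -[leRHS]sqrtr1 ler_wsqrtr.
    by rewrite /y; lra.
  by rewrite !profE eq_xc.
move/eqP; rewrite eqf_sqr => /orP [/eqP h|/eqP h]; [left|right]; lra.
Qed.

(** Removing open balls around c and 1 - c leaves a compact set, on which the maximum is attained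
    and is strictly smaller. If the set is empty, any positive delta serves. *)
Lemma density_gap k (c eps : R) :
    (forall x, 0 <= x <= 1 -> (density k).[x] <= (density k).[c]) ->
    (forall x, 0 <= x <= 1 -> (density k).[x] = (density k).[c] -> x = c \/ x = 1 - c) ->
    0 < eps ->
  exists2 delta, 0 < delta & forall x, 0 <= x <= 1 ->
    eps <= `|x - c| -> eps <= `|x - (1 - c)| -> (density k).[x] <= (density k).[c] - delta.
Proof.
move=> max_c uniq_c eps_gt0.
pose A : set R := `[0, 1] `&` (~` ball c eps `&` ~` ball (1 - c) eps).
have inA x : A x <-> [/\ 0 <= x <= 1, eps <= `|x - c| & eps <= `|x - (1 - c)|].
  rewrite /A /ball /= in_itv /=.
  split=> [[x01 [/negP h1 /negP h2]]|[x01 h1 h2]].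
    by rewrite -!leNgt in h1 h2; rewrite [`|x - c|]distrC [`|x - (1 - c)|]distrC.
  by split=> //; split; apply/negP; rewrite -leNgt distrC.
have compA : compact A.
  apply: subclosed_compact (@segment_compact _ 0 1) _; last by move=> x [].
  apply: closedI; first exact: itv_closed.
  by apply: closedI; apply: open_closedC; exact: ball_open.
have [A0|/set0P A_neq0] := eqVneq A set0.
  exists 1 => // x x01 h1 h2; have : A x by apply/inA.
  by rewrite A0.
have [a Aa max_a] := compact_EVT_max A_neq0 compA
  (continuous_subspaceT (@continuous_horner _ (density k))).
have /inA [a01 h1 h2] : A a by rewrite inE in Aa.
exists ((density k).[c] - (density k).[a]).
  rewrite subr_gt0 lt_neqAle max_c // andbT; apply/eqP => /(uniq_c _ a01) [] eq_a.
    by move: h1; rewrite eq_a subrr normr0 leNgt eps_gt0.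
  by move: h2; rewrite eq_a subrr normr0 leNgt eps_gt0.
move=> x x01 hx1 hx2; rewrite opprB addrC subrK; apply: max_a; rewrite inE; exact/inA.
Qed.
End Density.

(** * From real densities to integer class sizes *)

Definition bip_power (p n a : nat) : nat := (a * (n - a) ^ p + (n - a) * a ^ p)%N.

Lemma bip_power_density (R : realType) q n a : (0 < n)%N -> (a <= n)%N ->
  (bip_power q.+1 n a)%:R = n%:R ^+ q.+2 * (density R q).[a%:R / n%:R] :> R.
Proof.
move=> n_gt0 le_an; have n_neq0 : n%:R != 0 :> R by rewrite pnatr_eq0 -lt0n.
rewrite densityE (_ : 1 - a%:R / n%:R = (n - a)%:R / n%:R); last first.
  by rewrite natrB // mulrBl divff.
rewrite natrD !natrM !natrX !expr_div_n !exprS; field.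
by rewrite n_neq0 expf_neq0.
Qed.

(** The competitor b = floor(cn) has density within delta of the maximum, hence so has an optimal a;
    the gap then places a/n near c or 1 - c. *)
Lemma optimal_size_concentrates (R : realType) q : exists c : R, forall eps, 0 < eps ->
  exists N, forall n a, (N <= n)%N -> (a <= n)%N ->
    (forall b, (b <= n)%N -> (bip_power q.+1 n b <= bip_power q.+1 n a)%N) ->
  `|a%:R - c * n%:R| <= eps * n%:R \/ `|(n - a)%:R - c * n%:R| <= eps * n%:R.
Proof.
have [c [/andP [c_ge0 c_le1] max_c uniq_c]] := density_argmax R q.
exists c => eps eps_gt0.
have [delta delta_gt0 gap] := density_gap max_c uniq_c eps_gt0.
have /cvgrPdist_lt /(_ _ delta_gt0) /nbhs_ballP [eta /= eta_gt0 near_c] :=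
  @continuous_horner R (density R q) c.
(* This makes 1/n < eta, so rounding cn down stays in the continuity ball. *)
exists (Num.truncn eta^-1).+1 => n a le_n le_an opt.
have n_gt0 : (0 < n)%N by lia.
have nR_gt0 : 0 < n%:R :> R by rewrite ltr0n.
have n_neq0 : n%:R != 0 :> R by rewrite gt_eqF.
have eta_n : 1 < eta * n%:R.
  rewrite -ltr_pdivrMl // mulr1; apply: lt_le_trans (truncnS_gt _) _.
  by rewrite ler_nat.
pose b := Num.truncn (c * n%:R).
have cn_ge0 : 0 <= c * n%:R by rewrite mulr_ge0 ?ler0n.
have /andP [b_le b_gt] := truncn_itv cn_ge0; rewrite -/b -natr1 in b_le b_gt.
have le_bn : (b <= n)%N.
  by rewrite -(ler_nat R); apply: le_trans b_le _; rewrite ler_piMl.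
have frac01 m : (m <= n)%N -> 0 <= (m%:R / n%:R : R) <= 1.
  by move=> le_mn; rewrite divr_ge0 //= ler_pdivrMr // mul1r ler_nat.
have dist_scale (d : R) m : `|m%:R - d * n%:R| = `|m%:R / n%:R - d| * n%:R.
  have -> : m%:R - d * n%:R = (m%:R / n%:R - d) * n%:R by rewrite mulrBl divfK.
  by rewrite normrM (gtr0_norm nR_gt0).
have near_b : (density R q).[c] - delta < (density R q).[b%:R / n%:R].
  have : ball c eta (b%:R / n%:R).
    rewrite /ball /= distrC -(ltr_pM2r nR_gt0) -dist_scale.
    by rewrite distrC ger0_norm; lra.
  by move/near_c => /=; rewrite ltr_distl => /andP [_]; lra.
have le_ba : (density R q).[b%:R / n%:R] <= (density R q).[a%:R / n%:R].
  rewrite -(ler_pM2l (exprn_gt0 q.+2 nR_gt0)) -!bip_power_density // ler_nat.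
  exact: opt.
have [le_eps|gt_eps] := leP `|a%:R / n%:R - c| eps.
  by left; rewrite dist_scale ler_pM2r.
have [le_eps|gt_eps'] := leP `|a%:R / n%:R - (1 - c)| eps.
  right; rewrite natrB // (_ : _ - _ = - (a%:R - (1 - c) * n%:R)); last by ring.
  by rewrite normrN dist_scale ler_pM2r.
have := gap _ (frac01 _ le_an) (ltW gt_eps) (ltW gt_eps'); lra.
Qed.

Lemma optimal_size_littleo (R : realType) q : exists (c : R) (r : nat -> R),
  r =o_\oo (fun n : nat => n%:R : R) /\
  forall n a, (a <= n)%N ->
    (forall b, (b <= n)%N -> (bip_power q.+1 n b <= bip_power q.+1 n a)%N) ->
  `|a%:R - c * n%:R| <= r n \/ `|(n - a)%:R - c * n%:R| <= r n.
Proof.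
have [c conc] := optimal_size_concentrates R q; exists c.
pose dev n a : R := Num.min `|a%:R - c * n%:R| `|(n - a)%:R - c * n%:R|.
pose opt n (a : nat) := [forall b : 'I_n.+1, bip_power q.+1 n b <= bip_power q.+1 n a]%N.
(* The worst deviation over all optimal sizes, so that one function of n serves every extremal
   graph; it is 0 if there is none. *)
pose r n := \big[Num.max/0]_(a < n.+1 | opt n a) dev n a.
exists r; split.
  apply/eqoP => eps eps_gt0; have [N concN] := conc eps eps_gt0.
  near=> n; have le_Nn : (N <= n)%N by near: n; exact: nbhs_infty_ge.
  rewrite [`|n%:R|]ger0_norm ?ler0n // ger0_norm; last first.
    rewrite /r; apply: (big_ind (fun x : R => 0 <= x)) => // [x y x_ge0 y_ge0|a _]; last first.
      by rewrite le_min !normr_ge0.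
    by rewrite le_max x_ge0.
  apply: bigmax_le => [|a /forallP opt_a]; first by rewrite mulr_ge0 // ltW.
  rewrite ge_min; apply/orP; apply: concN => // [|b le_b]; first by rewrite -ltnS.
  by have := opt_a (inord b); rewrite inordK.
move=> n a le_an opt_a; have : dev n a <= r n.
  have lt_an : (a < n.+1)%N by [].
  apply: (@le_bigmax_cond _ _ _ _ (Ordinal lt_an) (fun i : 'I_n.+1 => opt n i) (dev n)).
  by apply/forallP => b; apply: opt_a; rewrite -ltnS.
by rewrite ge_min => /orP.
Unshelve. all: by end_near.
Qed.

(** One [r] covers both error terms: the class sizes sum to n, so the two deviations have equal
    absolute value. Which class is named [A] depends on whether |X| or its complement is close to
    cn. *)
Theorem theorem1 (R : realType) (p : nat) (hp : (0 < p)%N) :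
  exists (c : R) (r : nat -> R),
    r =o_\oo (fun n : nat => n%:R : R) /\
    exists N : nat, forall n : nat, (N <= n)%N ->
      forall (T : finType) (e : rel T),
        #|T| = n -> simple_graph e -> C5_free e ->
        degree_power p e = ex_C5 p n ->
        exists A B : {set T},
          [/\ complete_bipartite e A B,
              `| #|A|%:R - c * n%:R | <= r n
            & `| #|B|%:R - (1 - c) * n%:R | <= r n].
Proof.
case: p hp => // q _; have [c [r [r_o near_c]]] := optimal_size_littleo R q.
exists c, r; split=> //; have [N0 ext_bip] := extremal_is_bip q.
exists N0 => n le_n T e cardT simp_e C5F ext; rewrite -cardT in le_n ext.
have [X [X_neq0 CX_neq0 eX]] := ext_bip T e le_n simp_e C5F ext.
have cardCX : #|~: X| = (n - #|X|)%N by rewrite cardsCs finset.setCK cardT.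
have le_Xn : (#|X| <= n)%N by rewrite -cardT max_card.
have bipX : complete_bipartite e X (~: X).
  split=> //; [exact: finset.setUCr|by rewrite finset.disjoints_subset finset.setCK|].
  by move=> x y; rewrite eX /bip !inE; do 2 case: (_ \in _).
have bipCX : complete_bipartite e (~: X) X.
  split=> //; first by rewrite finset.setUC finset.setUCr.
    by rewrite disjoint_sym finset.disjoints_subset finset.setCK.
  by move=> x y; rewrite eX /bip !inE; do 2 case: (_ \in _).
have deg_e : degree_power q.+1 e = bip_power q.+1 n #|X|.
  rewrite /bip_power -cardCX -degree_power_bip; apply: eq_bigr => x _; congr (_ ^ _)%N.
  by apply: eq_card => y; rewrite !inE eX.
case: (near_c n #|X| le_Xn) => [b le_bn|le_r|le_r].
- by rewrite -deg_e ext cardT; exact: bip_ex_C5.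
- exists X, (~: X); split=> //.
  by rewrite cardCX natrB // (_ : _ - _ = - (#|X|%:R - c * n%:R)) ?normrN //; ring.
exists (~: X), X; rewrite cardCX; split=> //; move: le_r; rewrite natrB // => le_r.
by rewrite (_ : _ - _ = - (n%:R - #|X|%:R - c * n%:R)) ?normrN //; ring.
Qed.
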